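(* Let $(H,\beta,S_H)$ be a Hom-Hopf algebra over a field $K$, and let $(A,\alpha)$ be a Hom-algebra and a Hom-coalgebra (with the same automorphism $\alpha$). Assume that $(A,\alpha)$ is a left $(H,\beta)$-module Hom-algebra (action $\rhd$) and a left $(H,\beta)$-comodule Hom-coalgebra (coaction $\rho(a)=a_{-1}\otimes a_0$) such that $A\otimes H$ with automorphism $\alpha\otimes\beta$, multiplication $(a\otimes h)(a'\otimes h')=a(h_1\rhd\alpha^{-1}(a'))\otimes\beta^{-1}(h_2)h'$, unit $1_A\otimes1_H$, comultiplication $\Delta(a\otimes h)=a_1\otimes a_{2\,-1}\beta^{-1}(h_1)\otimes\alpha^{-1}(a_{2\,0})\otimes h_2$ and counit $\varepsilon_A\otimes\varepsilon_H$ is a Hom-bialgebra (the Radford biproduct Hom-bialgebra). Let $S_A:A\to A$ be a linear map such that $S_A(a_1)a_2=a_1S_A(a_2)=\varepsilon_A(a)1_A$ for all $a\in A$ and $\alpha\circ S_A=S_A\circ\alpha$. Then this Hom-bialgebra is a Hom-Hopf algebra with antipode $$S(a\otimes h)=\bigl(S_H(a_{-1}\beta^{-1}(h))_1\rhd S_A(\alpha^{-2}(a_0))\bigr)\otimes\beta^{-1}\bigl(S_H(a_{-1}\beta^{-1}(h))_2\bigr)\qquad(a\in A,\ h\in H).$$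
   Context: All spaces are over a field $K$. Sweedler-type notation: $\Delta(c)=c_1\otimes c_2$, $\Delta(c_1)=c_{11}\otimes c_{12}$, etc., summation understood; $a_{2\,-1}\otimes a_{2\,0}=\rho(a_2)$; $S_H(x)_1\otimes S_H(x)_2=\Delta(S_H(x))$. Hom-algebra $(A,\mu,1_A,\alpha)$ (abbr. $(A,\alpha)$): a vector space $A$, a linear map $\mu:A\otimes A\to A$, $a\otimes a'\mapsto aa'$, an element $1_A\in A$ and a bijective linear map $\alpha:A\to A$ with $\alpha(aa')=\alpha(a)\alpha(a')$, $\alpha(1_A)=1_A$, $\alpha(a)(a'a'')=(aa')\alpha(a'')$, $a1_A=1_Aa=\alpha(a)$. Hom-coalgebra $(C,\Delta,\varepsilon_C,\beta)$ (abbr. $(C,\beta)$): a vector space $C$, linear maps $\Delta:C\to C\otimes C$, $\varepsilon_C:C\to K$ and a bijective linear map $\beta:C\to C$ with $\Delta(\beta(c))=\beta(c_1)\otimes\beta(c_2)$, $\varepsilon_C\circ\beta=\varepsilon_C$, $\beta(c_1)\otimes c_{21}\otimes c_{22}=c_{11}\otimes c_{12}\otimes\beta(c_2)$, $\varepsilon_C(c_1)c_2=c_1\varepsilon_C(c_2)=\beta(c)$. Hom-bialgebra $(H,\mu,1_H,\Delta,\varepsilon,\beta)$ (abbr. $(H,\beta)$): $(H,\mu,1_H,\beta)$ is a Hom-algebra, $(H,\Delta,\varepsilon,\beta)$ is a Hom-coalgebra, and $\Delta(hh')=h_1h'_1\otimes h_2h'_2$, $\Delta(1_H)=1_H\otimes1_H$,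 $\varepsilon(hh')=\varepsilon(h)\varepsilon(h')$, $\varepsilon(1_H)=1$. A Hom-Hopf algebra $(H,\beta,S)$ is a Hom-bialgebra with a linear map $S:H\to H$ (antipode) such that $S(h_1)h_2=h_1S(h_2)=\varepsilon(h)1_H$ and $S(\beta(h))=\beta(S(h))$. Left $(H,\beta)$-Hom-module $(M,\rhd,\alpha)$ over a Hom-algebra $(H,\beta)$: a vector space $M$, a linear map $\rhd:H\otimes M\to M$ and a bijective linear map $\alpha:M\to M$ with $\alpha(h\rhd m)=\beta(h)\rhd\alpha(m)$, $\beta(h)\rhd(h'\rhd m)=(hh')\rhd\alpha(m)$, $1_H\rhd m=\alpha(m)$. Left $(H,\beta)$-Hom-comodule $(M,\rho,\alpha)$ over a Hom-coalgebra $(H,\beta)$: a vector space $M$, a linear map $\rho:M\to H\otimes M$, $\rho(m)=m_{-1}\otimes m_0$, and a bijective linear map $\alpha:M\to M$ with $\rho(\alpha(m))=\beta(m_{-1})\otimes\alpha(m_0)$, $\beta(m_{-1})\otimes m_{0\,-1}\otimes m_{0\,0}=m_{-1\,1}\otimes m_{-1\,2}\otimes\alpha(m_0)$, $\varepsilon(m_{-1})m_0=\alpha(m)$. Let $(H,\beta)$ be a Hom-bialgebra. - $(H,\beta)$-module Hom-algebra $(A,\rhd,\alpha)$: $(A,\alpha)$ is a Hom-algebra, $(A,\rhd,\alpha)$ is a left $(H,\beta)$-Hom-module, $\beta^2(h)\rhd(aa')=(h_1\rhd a)(h_2\rhd a')$ and $h\rhd1_A=\varepsilon(h)1_A$. -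 $(H,\beta)$-comodule Hom-coalgebra $(C,\rho,\alpha)$: $(C,\alpha)$ is a Hom-coalgebra, $(C,\rho,\alpha)$ is a left $(H,\beta)$-Hom-comodule, $\beta^2(c_{-1})\otimes c_{0\,1}\otimes c_{0\,2}=c_{1\,-1}c_{2\,-1}\otimes c_{1\,0}\otimes c_{2\,0}$ and $c_{-1}\varepsilon_C(c_0)=1_H\varepsilon_C(c)$. *)

(* Defs.v *)
From HB Require Import structures.
From mathcomp Require Import all_boot all_order all_algebra.
From mathcomp Require Import boolp classical_sets functions.
From mathcomp Require Import freeg.

Set Implicit Arguments.
Unset Strict Implicit.
Unset Printing Implicit Defensive.

Import GRing.Theory.

Local Open Scope ring_scope.
Local Open Scope quotient_scope.

(* The tensor product over K, as the quotient of the free K-module on A * B   *)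
(* by the submodule generated by the bilinearity relations.                   *)
Section TensorProduct.
Context (K : fieldType) (A B : lmodType K).

Inductive bilinearity_relation : {freeg (A * B) / K} -> Prop :=
| BrelDl a a' b :
    bilinearity_relation (<< (a + a', b) >> - << (a, b) >> - << (a', b) >>)
| BrelDr a b b' :
    bilinearity_relation (<< (a, b + b') >> - << (a, b) >> - << (a, b') >>)
| BrelZl k a b : bilinearity_relation (<< (k *: a, b) >> - k *: << (a, b) >>)
| BrelZr k a b : bilinearity_relation (<< (a, k *: b) >> - k *: << (a, b) >>)
| Brel0 : bilinearity_relation 0
| BrelD x y : bilinearity_relation x -> bilinearity_relation y ->
    bilinearity_relation (x + y)
| BrelZ k x : bilinearity_relation x -> bilinearity_relation (k *: x).

Definition relations : {pred {freeg (A * B) / K}} :=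
  fun x => `[< bilinearity_relation x >].

Lemma relations_zmod_closed : zmod_closed relations.
Proof.
split; first exact/asboolP/Brel0.
move=> x y /asboolP rx /asboolP ry; apply/asboolP; apply: BrelD => //.
by rewrite -scaleN1r; apply: BrelZ.
Qed.

HB.instance Definition _ :=
  GRing.isZmodClosed.Build {freeg (A * B) / K} relations relations_zmod_closed.

Definition tensor : Type := Quotient.quot relations.

HB.instance Definition _ := Quotient.on tensor.
HB.instance Definition _ := GRing.Zmodule.on tensor.

Definition tensor_pi (x : {freeg (A * B) / K}) : tensor := \pi_tensor x.
Definition tensor_repr (t : tensor) : {freeg (A * B) / K} := repr t.

Lemma tensor_reprK : cancel tensor_repr tensor_pi.
Proof. exact: reprK. Qed.

Lemma tensor_pi_eq x y :
  (tensor_pi x = tensor_pi y) <-> bilinearity_relation (x - y).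
Proof.
by split=> [/eqmodP /= /asboolP | /asboolP h] //; apply/eqmodP.
Qed.

Lemma tensor_piB : {morph tensor_pi : x y / x - y >-> x - y}.
Proof. by move=> x y; exact: (@pi_is_zmod_morphism _ _ _ (Quotient.quot relations)). Qed.

Lemma tensor_piD : {morph tensor_pi : x y / x + y >-> x + y}.
Proof.
move=> x y; have := tensor_piB (x + y) y; rewrite addrK => ->.
by rewrite subrK.
Qed.

Definition tensor_scale (k : K) (t : tensor) : tensor :=
  tensor_pi (k *: tensor_repr t).

Lemma tensor_piZ k x : tensor_pi (k *: x) = tensor_scale k (tensor_pi x).
Proof.
apply/tensor_pi_eq; rewrite -scalerBr; apply/BrelZ/tensor_pi_eq.
by rewrite tensor_reprK.
Qed.

Fact tensor_scalerA a b t :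
  tensor_scale a (tensor_scale b t) = tensor_scale (a * b) t.
Proof. by rewrite -(tensor_reprK t) -!tensor_piZ scalerA. Qed.

Fact tensor_scale1r : left_id 1 tensor_scale.
Proof. by move=> t; rewrite -(tensor_reprK t) -tensor_piZ scale1r. Qed.

Fact tensor_scalerDr : right_distributive tensor_scale +%R.
Proof.
move=> k t u; rewrite -(tensor_reprK t) -(tensor_reprK u).
by rewrite -tensor_piD -!tensor_piZ scalerDr tensor_piD.
Qed.

Fact tensor_scalerDl t : {morph tensor_scale^~ t : a b / a + b}.
Proof.
move=> a b /=; rewrite -(tensor_reprK t) -!tensor_piZ.
by rewrite scalerDl tensor_piD.
Qed.

HB.instance Definition _ := GRing.Zmodule_isLmodule.Build K tensor
  tensor_scalerA tensor_scale1r tensor_scalerDr tensor_scalerDl.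

Definition tens (a : A) (b : B) : tensor := tensor_pi << (a, b) >>.

(* [sweedler t F] is the linear extension of [F] at [t]: for [F] bilinear it  *)
(* is the value at [t] of the linear map [a ⊗ b |-> F a b], independently of  *)
(* the way [t] is written as a sum of pure tensors (see [sweedler_tens],      *)
(* [sweedler_linear] and [tensor_sum]); for other [F] it depends on the       *)
(* representative chosen by [repr].                                           *)
Definition sweedler (W : lmodType K) (t : tensor) (F : A -> B -> W) : W :=
  fglift (fun p => F p.1 p.2) (repr t).

End TensorProduct.

Arguments tensor {K} A%_type B%_type.
Arguments tens {K A B} a%_R b%_R.
Arguments sweedler {K A B W} t%_R F%_function_scope.

Notation "A ⊗ B" := (tensor A B) (at level 40, left associativity) : type_scope.
Notation "a ⊗ b" := (tens a b) (at level 40, left associativity) : ring_scope.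

Notation "'\sw_' ( x , y <- t ) E" := (sweedler t (fun x y => E))
  (at level 41, x binder, y binder, t at level 200, E at level 41, right associativity,
   format "'[' '\sw_' ( x ,  y  <-  t ) '/  '  E ']'") : ring_scope.


Section TensorTheory.
Context (K : fieldType).
Implicit Types A B U V W X : lmodType K.

Fact tens_bilinear A B : bilinear_for *:%R *:%R (@tens K A B).
Proof.
have PZ k (x : {freeg (A * B) / K}) : tensor_pi (k *: x) = k *: tensor_pi x.
  exact: tensor_piZ.
split=> [b k a a' | a k b b']; rewrite /= /tens.
  rewrite -PZ -tensor_piD; apply: etrans (_ : tensor_pi
    (<< (k *: a, b) >> + << (a', b) >>) = _).
    by apply/tensor_pi_eq; rewrite opprD addrA; apply: BrelDl.
  by rewrite !tensor_piD; congr (_ + _); apply/tensor_pi_eq/BrelZl.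
rewrite -PZ -tensor_piD; apply: etrans (_ : tensor_pi
  (<< (a, k *: b) >> + << (a, b') >>) = _).
  by apply/tensor_pi_eq; rewrite opprD addrA; apply: BrelDr.
by rewrite !tensor_piD; congr (_ + _); apply/tensor_pi_eq/BrelZr.
Qed.

Fact fglift_linear (T : choiceType) W (f : T -> W) :
  linear (fglift f : {freeg T / K} -> W).
Proof.
have D x y : fglift f (x + y) = fglift f x + fglift f y.
  rewrite -(freeg_repr x) -(freeg_repr y) -freeg_cat !fglift_Freeg.
  exact: prelift_cat.
have U k z : fglift f << k *g z >> = k *: f z by exact: liftU.
have Z0 : fglift f 0 = 0 by rewrite -freeg_nil fglift_Freeg prelift_nil.
have S (I : Type) (r : seq I) (F : I -> {freeg T / K}) :
    fglift f (\sum_(i <- r) F i) = \sum_(i <- r) fglift f (F i).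
  by apply: (big_morph _ D Z0).
move=> k x y; rewrite D; congr (_ + _).
rewrite -{2}(freeg_sumE x) S scaler_sumr [k *: x]/(fgscale k x) S.
by apply: eq_bigr => z _; rewrite !U scalerA.
Qed.

Fact linearPB A W (f : A -> W) : linear f ->
  [/\ forall x y, f (x + y) = f x + f y, forall x y, f (x - y) = f x - f y,
      forall k x, f (k *: x) = k *: f x & f 0 = 0].
Proof.
move=> lf; pose g := HB.pack_for {linear A -> W} f (GRing.isLinear.Build K A W *:%R f lf).
by split; [exact: (linearD g) | exact: (linearB g) | exact: (linearZZ g)
          | exact: (linear0 g)].
Qed.

Fact sweedler_pi A B W (F : A -> B -> W) (x : {freeg (A * B) / K}) :
  bilinear_for *:%R *:%R F ->
  sweedler (tensor_pi x) F = fglift (fun p => F p.1 p.2) x.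
Proof.
case=> Fl Fr; have [LD LB LZ L0] := linearPB (fglift_linear (fun p => F p.1 p.2)).
apply/eqP; rewrite -subr_eq0 -LB; apply/eqP.
have : bilinearity_relation (tensor_repr (tensor_pi x) - x).
  by apply/tensor_pi_eq; rewrite tensor_reprK.
move: (_ - x) => r; elim=> {r} [a a' b|a b b'|k a b|k a b||u v _ fu _ fv|k u _ fu].
- have [D _ _ _] := linearPB (Fl b).
  by rewrite !LB !liftU !scale1r /= D addrAC addrK subrr.
- have [D _ _ _] := linearPB (Fr a).
  by rewrite !LB !liftU !scale1r /= D addrAC addrK subrr.
- have [_ _ Z _] := linearPB (Fl b).
  by rewrite LB LZ !liftU !scale1r /= Z subrr.
- have [_ _ Z _] := linearPB (Fr a).
  by rewrite LB LZ !liftU !scale1r /= Z subrr.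
- by [].
- by rewrite LD fu fv addr0.
- by rewrite LZ fu scaler0.
Qed.

Lemma sweedler_tens A B W (F : A -> B -> W) a b :
  bilinear_for *:%R *:%R F -> sweedler (tens a b) F = F a b.
Proof. by move=> bF; rewrite sweedler_pi // liftU scale1r. Qed.

Lemma sweedler_linear A B W (F : A -> B -> W) :
  bilinear_for *:%R *:%R F -> linear (sweedler^~ F).
Proof.
move=> bF k t u; rewrite -(tensor_reprK t) -(tensor_reprK u).
have -> : k *: tensor_pi (tensor_repr t) + tensor_pi (tensor_repr u) =
          tensor_pi (k *: tensor_repr t + tensor_repr u).
  by rewrite tensor_piD tensor_piZ.
by rewrite !sweedler_pi // fglift_linear.
Qed.

Lemma tensor_sum A B (t : tensor A B) :
  exists s : seq (A * B), t = \sum_(p <- s) tens p.1 p.2.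
Proof.
pose D := tensor_repr t.
exists [seq (coeff z D *: z.1, z.2) | z <- dom D].
have piS (r : seq (A * B)) (F : A * B -> {freeg (A * B) / K}) :
    tensor_pi (\sum_(i <- r) F i) = \sum_(i <- r) tensor_pi (F i).
  apply: big_morph => [x y|]; first exact: tensor_piD.
  by have := tensor_piB 0 (0 : {freeg (A * B) / K}); rewrite subr0 subrr.
rewrite -{1}(tensor_reprK t) -/D -{1}(freeg_sumE D) piS [RHS]big_map.
apply: eq_bigr => -[a b] _ /=;
have [_ _ -> _] := linearPB ((tens_bilinear A B).1 b).
have -> : coeff (a, b) D *: tens a b = tensor_pi (coeff (a, b) D *: << (a, b) >>).
  by rewrite tensor_piZ.
congr tensor_pi; apply/eqP/freeg_eqP => z.
by rewrite coeffZ !coeffU mul1r.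
Qed.

Lemma sweedler_body_linear A B U W (t : tensor A B) (F : U -> A -> B -> W) :
  (forall a b, linear (fun u => F u a b)) -> linear (fun u => sweedler t (F u)).
Proof.
move=> lF k u v; rewrite /sweedler -(freeg_repr (repr t)) !fglift_Freeg.
rewrite /prelift scaler_sumr -big_split; apply: eq_bigr => p _ /=.
by rewrite lF scalerDr scalerA mulrC -scalerA.
Qed.

Fact id_lin V : linear (fun x : V => x).
Proof. by []. Qed.

Fact comp_lin U V W (f : V -> W) (g : U -> V) :
  linear f -> linear g -> linear (fun x => f (g x)).
Proof. by move=> lf lg k x y; rewrite lg lf. Qed.

Fact tensl_lin U V W (f : U -> V) (w : W) :
  linear f -> linear (fun x => f x ⊗ w).
Proof.
by move=> lf k x y; rewrite lf; apply: (tens_bilinear V W).1.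
Qed.

Fact tensr_lin U V W (f : U -> V) (w : W) :
  linear f -> linear (fun x => w ⊗ f x).
Proof.
by move=> lf k x y; rewrite lf; apply: (tens_bilinear W V).2.
Qed.

Fact sweedler_comp_lin U V W X (f : U -> V ⊗ W)
    (F : V -> W -> X) :
  linear f -> (forall w, linear (fun v => F v w)) ->
  (forall v, linear (fun w => F v w)) ->
  linear (fun u => sweedler (f u) F).
Proof.
move=> lf Fl Fr; apply: (comp_lin (f := sweedler^~ F)) => //.
by apply: sweedler_linear; split.
Qed.

End TensorTheory.

(* Only meaningful for bijective [f].                                         *)
Definition inverse (K : fieldType) (V : lmodType K) (f : V -> V) : V -> V :=
  'pinv_(fun=> 0) [set: V]%classic f.

Section Inverse.
Context (K : fieldType) (V : lmodType K) (f : V -> V).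
Hypothesis bij_f : bijective f.

Lemma inverseK : cancel f (inverse f).
Proof.
by move=> x; apply: pinvKV; [move=> ? ? _ _ /(bij_inj bij_f) | rewrite in_setT].
Qed.

Lemma inverseVK : cancel (inverse f) f.
Proof.
by move=> x; apply: pinvK; rewrite inE; case: bij_f => g _ fK; exists (g x).
Qed.

Lemma inverse_linear : linear f -> linear (inverse f).
Proof.
by move=> lf k x y; apply: (bij_inj bij_f); rewrite lf !inverseVK.
Qed.

End Inverse.

Section HomStructures.
Context (K : fieldType).
Implicit Types A C H M : lmodType K.

Record hom_algebra A (mul : A ⊗ A -> A) (one : A) (alpha : A -> A) : Prop :=
  HomAlgebra {
    hom_mul_linear : linear mul;
    hom_alg_aut_linear : linear alpha;
    hom_alg_aut_bij : bijective alpha;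
    hom_alg_autM : forall a a', alpha (mul (a ⊗ a')) = mul (alpha a ⊗ alpha a');
    hom_alg_aut1 : alpha one = one;
    hom_mulA : forall a a' a'',
      mul (alpha a ⊗ mul (a' ⊗ a'')) = mul (mul (a ⊗ a') ⊗ alpha a'');
    hom_mulr1 : forall a, mul (a ⊗ one) = alpha a;
    hom_mul1r : forall a, mul (one ⊗ a) = alpha a
  }.

Record hom_coalgebra C (Delta : C -> C ⊗ C) (eps : C -> K^o) (beta : C -> C)
    : Prop := HomCoalgebra {
    hom_comul_linear : linear Delta;
    hom_counit_linear : linear eps;
    hom_coalg_aut_linear : linear beta;
    hom_coalg_aut_bij : bijective beta;
    hom_comul_aut : forall c,
      Delta (beta c) = \sw_(c1, c2 <- Delta c) (beta c1 ⊗ beta c2);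
    hom_counit_aut : forall c, eps (beta c) = eps c;
    hom_comulA : forall c,
      \sw_(c1, c2 <- Delta c) \sw_(c21, c22 <- Delta c2)
         (beta c1 ⊗ (c21 ⊗ c22)) =
      \sw_(c1, c2 <- Delta c) \sw_(c11, c12 <- Delta c1)
         (c11 ⊗ (c12 ⊗ beta c2));
    hom_counitl : forall c, \sw_(c1, c2 <- Delta c) (eps c1 *: c2) = beta c;
    hom_counitr : forall c, \sw_(c1, c2 <- Delta c) (eps c2 *: c1) = beta c
  }.

Record hom_bialgebra H (mul : H ⊗ H -> H) (one : H) (Delta : H -> H ⊗ H)
    (eps : H -> K^o) (beta : H -> H) : Prop := HomBialgebra {
    hom_bialg_alg : hom_algebra mul one beta;
    hom_bialg_coalg : hom_coalgebra Delta eps beta;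
    hom_comulM : forall h h',
      Delta (mul (h ⊗ h')) =
      \sw_(h1, h2 <- Delta h) \sw_(h1', h2' <- Delta h')
         (mul (h1 ⊗ h1') ⊗ mul (h2 ⊗ h2'));
    hom_comul1 : Delta one = one ⊗ one;
    hom_counitM : forall h h', eps (mul (h ⊗ h')) = eps h * eps h';
    hom_counit1 : eps one = 1
  }.

Record hom_antipode H (mul : H ⊗ H -> H) (one : H) (Delta : H -> H ⊗ H)
    (eps : H -> K^o) (beta S : H -> H) : Prop := HomAntipode {
    hom_antipode_linear : linear S;
    hom_antipodel : forall h,
      \sw_(h1, h2 <- Delta h) mul (S h1 ⊗ h2) = eps h *: one;
    hom_antipoder : forall h,
      \sw_(h1, h2 <- Delta h) mul (h1 ⊗ S h2) = eps h *: one;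
    hom_antipode_aut : forall h, S (beta h) = beta (S h)
  }.

Record hom_hopf_algebra H (mul : H ⊗ H -> H) (one : H) (Delta : H -> H ⊗ H)
    (eps : H -> K^o) (beta S : H -> H) : Prop := HomHopfAlgebra {
    hom_hopf_bialg : hom_bialgebra mul one Delta eps beta;
    hom_hopf_antipode : hom_antipode mul one Delta eps beta S
  }.

Record hom_module H (mul : H ⊗ H -> H) (one : H) (beta : H -> H)
    M (act : H ⊗ M -> M) (alpha : M -> M) : Prop := HomModule {
    hom_act_linear : linear act;
    hom_mod_aut_linear : linear alpha;
    hom_mod_aut_bij : bijective alpha;
    hom_act_aut : forall h m, alpha (act (h ⊗ m)) = act (beta h ⊗ alpha m);
    hom_actA : forall h h' m,
      act (beta h ⊗ act (h' ⊗ m)) = act (mul (h ⊗ h') ⊗ alpha m);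
    hom_act1 : forall m, act (one ⊗ m) = alpha m
  }.

(* The variables [m_1], [m_11] stand for m_{-1}, m_{-1 1}, and so on.         *)
Record hom_comodule H (Delta : H -> H ⊗ H) (eps : H -> K^o) (beta : H -> H)
    M (rho : M -> H ⊗ M) (alpha : M -> M) : Prop := HomComodule {
    hom_coact_linear : linear rho;
    hom_comod_aut_linear : linear alpha;
    hom_comod_aut_bij : bijective alpha;
    hom_coact_aut : forall m,
      rho (alpha m) = \sw_(m_1, m0 <- rho m) (beta m_1 ⊗ alpha m0);
    hom_coactA : forall m,
      \sw_(m_1, m0 <- rho m) \sw_(m0_1, m00 <- rho m0)
         (beta m_1 ⊗ (m0_1 ⊗ m00)) =
      \sw_(m_1, m0 <- rho m) \sw_(m_11, m_12 <- Delta m_1)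
         (m_11 ⊗ (m_12 ⊗ alpha m0));
    hom_coact1 : forall m, \sw_(m_1, m0 <- rho m) (eps m_1 *: m0) = alpha m
  }.

Record module_hom_algebra
    H (mulH : H ⊗ H -> H) (oneH : H) (DeltaH : H -> H ⊗ H) (epsH : H -> K^o)
    (beta : H -> H)
    A (mulA : A ⊗ A -> A) (oneA : A) (act : H ⊗ A -> A) (alpha : A -> A)
    : Prop := ModuleHomAlgebra {
    mha_algebra : hom_algebra mulA oneA alpha;
    mha_module : hom_module mulH oneH beta act alpha;
    mha_actM : forall h a a',
      act (beta (beta h) ⊗ mulA (a ⊗ a')) =
      \sw_(h1, h2 <- DeltaH h) mulA (act (h1 ⊗ a) ⊗ act (h2 ⊗ a'));
    mha_act_one : forall h, act (h ⊗ oneA) = epsH h *: oneA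
  }.

Record comodule_hom_coalgebra
    H (mulH : H ⊗ H -> H) (oneH : H) (DeltaH : H -> H ⊗ H) (epsH : H -> K^o)
    (beta : H -> H)
    C (DeltaC : C -> C ⊗ C) (epsC : C -> K^o) (rho : C -> H ⊗ C)
    (alpha : C -> C) : Prop := ComoduleHomCoalgebra {
    chc_coalgebra : hom_coalgebra DeltaC epsC alpha;
    chc_comodule : hom_comodule DeltaH epsH beta rho alpha;
    chc_coact_comul : forall c,
      \sw_(c_1, c0 <- rho c) \sw_(c01, c02 <- DeltaC c0)
         (beta (beta c_1) ⊗ (c01 ⊗ c02)) =
      \sw_(c1, c2 <- DeltaC c)
      \sw_(c1_1, c10 <- rho c1) \sw_(c2_1, c20 <- rho c2)
         (mulH (c1_1 ⊗ c2_1) ⊗ (c10 ⊗ c20));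
    chc_coact_counit : forall c,
      \sw_(c_1, c0 <- rho c) (epsC c0 *: c_1) = epsC c *: oneH
  }.

End HomStructures.

(* The structure maps of the Radford biproduct, as linear extensions of their *)
(* values on pure tensors; these values are recovered, under the linearity    *)
(* assumptions which make them well defined, in the lemmas [biproduct_*E].    *)
Section Biproduct.
Context (K : fieldType) (H A : lmodType K).
Context (mulH : H ⊗ H -> H) (DeltaH : H -> H ⊗ H) (epsH : H -> K^o).
Context (beta SH : H -> H).
Context (mulA : A ⊗ A -> A) (DeltaA : A -> A ⊗ A) (epsA : A -> K^o).
Context (alpha SA : A -> A).
Context (act : H ⊗ A -> A) (rho : A -> H ⊗ A).

Definition biproduct_mul_pure (a : A) (h : H) (a' : A) (h' : H) : A ⊗ H :=
  \sw_(h1, h2 <- DeltaH h)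
    (mulA (a ⊗ act (h1 ⊗ inverse alpha a')) ⊗ mulH (inverse beta h2 ⊗ h')).

Definition biproduct_mul (t : (A ⊗ H) ⊗ (A ⊗ H)) : A ⊗ H :=
  \sw_(x, x' <- t) \sw_(a, h <- x) \sw_(a', h' <- x')
    biproduct_mul_pure a h a' h'.

Definition biproduct_comul_pure (a : A) (h : H) : (A ⊗ H) ⊗ (A ⊗ H) :=
  \sw_(a1, a2 <- DeltaA a) \sw_(a2_1, a20 <- rho a2)
  \sw_(h1, h2 <- DeltaH h)
    ((a1 ⊗ mulH (a2_1 ⊗ inverse beta h1)) ⊗ (inverse alpha a20 ⊗ h2)).

Definition biproduct_comul (x : A ⊗ H) : (A ⊗ H) ⊗ (A ⊗ H) :=
  \sw_(a, h <- x) biproduct_comul_pure a h.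

Definition biproduct_counit (x : A ⊗ H) : K^o :=
  \sw_(a, h <- x) (epsA a *: epsH h).

Definition biproduct_aut (x : A ⊗ H) : A ⊗ H :=
  \sw_(a, h <- x) (alpha a ⊗ beta h).

Definition biproduct_antipode_pure (a : A) (h : H) : A ⊗ H :=
  \sw_(a_1, a0 <- rho a)
  \sw_(s1, s2 <- DeltaH (SH (mulH (a_1 ⊗ inverse beta h))))
    (act (s1 ⊗ SA (inverse alpha (inverse alpha a0))) ⊗ inverse beta s2).

Definition biproduct_antipode (x : A ⊗ H) : A ⊗ H :=
  \sw_(a, h <- x) biproduct_antipode_pure a h.

Hypotheses (mulH_lin : linear mulH) (DeltaH_lin : linear DeltaH).
Hypotheses (epsH_lin : linear epsH) (beta_lin : linear beta).
Hypotheses (beta_bij : bijective beta) (SH_lin : linear SH).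
Hypotheses (mulA_lin : linear mulA) (DeltaA_lin : linear DeltaA).
Hypotheses (epsA_lin : linear epsA) (alpha_lin : linear alpha).
Hypotheses (alpha_bij : bijective alpha) (SA_lin : linear SA).
Hypotheses (act_lin : linear act) (rho_lin : linear rho).

Let betaV_lin := inverse_linear beta_bij beta_lin.
Let alphaV_lin := inverse_linear alpha_bij alpha_lin.

Ltac lin := intros;
  first [ exact: id_lin | assumption
  | apply: sweedler_body_linear; lin
  | apply: sweedler_comp_lin; lin
  | apply: tensl_lin; lin | apply: tensr_lin; lin
  | match goal with |- linear (fun x => ?f (@?g x)) =>
      apply: (@comp_lin _ _ _ _ f g); lin end ].

Lemma biproduct_mulE a h a' h' :
  biproduct_mul ((a ⊗ h) ⊗ (a' ⊗ h')) = biproduct_mul_pure a h a' h'.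
Proof.
rewrite /biproduct_mul !sweedler_tens //;
  by split; rewrite /biproduct_mul_pure; lin.
Qed.

Lemma biproduct_comulE a h :
  biproduct_comul (a ⊗ h) = biproduct_comul_pure a h.
Proof.
by rewrite /biproduct_comul sweedler_tens //; split; rewrite /biproduct_comul_pure; lin.
Qed.

Lemma biproduct_counitE a h : biproduct_counit (a ⊗ h) = epsA a *: epsH h.
Proof.
rewrite /biproduct_counit sweedler_tens //; split=> [h0|a0] k x y.
  by rewrite epsA_lin scalerDl -[k *: epsA x]/(k * epsA x) -scalerA.
by rewrite epsH_lin scalerDr; congr (_ + _); apply: (@mulrCA K).
Qed.

Lemma biproduct_autE a h : biproduct_aut (a ⊗ h) = alpha a ⊗ beta h.
Proof. by rewrite /biproduct_aut sweedler_tens //; split; lin. Qed.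

Lemma biproduct_antipodeE a h :
  biproduct_antipode (a ⊗ h) = biproduct_antipode_pure a h.
Proof.
by rewrite /biproduct_antipode sweedler_tens //; split;
  rewrite /biproduct_antipode_pure; lin.
Qed.

End Biproduct.

(* Main.v *)
(* Put i(h) = 1 ⊗ h and j(a) = a ⊗ 1 in the biproduct. The candidate antipode *)
(* is a product, S(a ⊗ h) = i(β^-1 S_H(a_{-1} β^-1(h))) j(S_A(α^-2(a_0))), so  *)
(* Hom-associativity of the biproduct brings the two antipodes next to their   *)
(* arguments. In S(x_1) x_2 the compatibility of the coaction with Δ_A lets    *)
(* S_A cancel first, then S_H; in x_1 S(x_2) coassociativity of the coaction   *)
(* and multiplicativity of Δ_H let S_H cancel first, then S_A.                 *)

Require Import Defs.
From mathcomp Require Import all_boot all_order all_algebra.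

Set Implicit Arguments.
Unset Strict Implicit.
Unset Printing Implicit Defensive.

Import GRing.Theory.

Local Open Scope ring_scope.

(** The biproduct is already a Hom-bialgebra, so only the antipode axioms are at stake; they are
    linear, and [tensor_ext] reduces them to pure tensors a ⊗ h. The key is the factorisation
    [biproduct_antipode_prod]. For S(x_1) x_2, [antipode_left_term] reassociates so that
    S_A(a_{1,0}) meets a_{2,0} while a_{1,-1} a_{2,-1} appears as one product. This is one side of
    the compatibility of ρ with Δ_A; on the other side S_A faces Δ_A(a_0) and cancels to ε_A(a_0).
    Then a_{-1} ε_A(a_0) = ε_A(a) 1_H removes the coaction, and S_H(h_1) h_2 is left. For x_1
    S(x_2), [antipode_right_term] gives (β(x) h_1) S_H(y h_2), with x and y the two legs of the
    iterated coaction of a_2. Coassociativity makes them the two halves of Δ_H(a_{2,-1}), so that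
    the product is u_1 S_H(u_2) with u = a_{2,-1} h. The counits then leave a_1 S_A(a_2). *)

Section SweedlerCalculus.
Context (K : fieldType).
Implicit Types A B C D U V W X : lmodType K.

(** * Sweedler sums: rules valid for any body, then rules for bilinear bodies *)

Lemma eq_sweedler A B W (t : A ⊗ B) (F G : A -> B -> W) :
  (forall a b, F a b = G a b) -> sweedler t F = sweedler t G.
Proof.
move=> eFG; rewrite /sweedler -(freeg.freeg_repr (generic_quotient.repr t)).
rewrite !freeg.fglift_Freeg /freeg.prelift.
by apply: eq_bigr => p _; rewrite eFG.
Qed.

(** No bilinearity of [F] is required: both sides are finite combinations over the same chosen
    representative of [t]. The same holds for [sweedler_exchange]. *)
Lemma linear_sweedler A B V W (f : V -> W) (t : A ⊗ B) (F : A -> B -> V) :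
  linear f -> f (sweedler t F) = sweedler t (fun a b => f (F a b)).
Proof.
move=> lf; have [fD _ fZ f0] := linearPB lf.
rewrite /sweedler -(freeg.freeg_repr (generic_quotient.repr t)).
rewrite !freeg.fglift_Freeg /freeg.prelift (big_morph f fD f0).
by apply: eq_bigr => p _; rewrite fZ.
Qed.

Lemma sweedler_exchange A B C D W (t : A ⊗ B) (u : C ⊗ D)
    (F : A -> B -> C -> D -> W) :
  \sw_(a, b <- t) \sw_(c, d <- u) F a b c d =
  \sw_(c, d <- u) \sw_(a, b <- t) F a b c d.
Proof.
rewrite /sweedler -(freeg.freeg_repr (generic_quotient.repr t)).
rewrite -(freeg.freeg_repr (generic_quotient.repr u)).
rewrite !freeg.fglift_Freeg /freeg.prelift.
under eq_bigr do rewrite freeg.fglift_Freeg /freeg.prelift scaler_sumr.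
rewrite exchange_big; apply: eq_bigr => q _.
rewrite freeg.fglift_Freeg /freeg.prelift scaler_sumr.
by apply: eq_bigr => p _; rewrite !scalerA mulrC.
Qed.

Lemma sweedler_pure A B W (F : A -> B -> W) a b :
  (forall b, linear (F^~ b)) -> (forall a, linear (F a)) ->
  sweedler (a ⊗ b) F = F a b.
Proof. by move=> Fl Fr; apply: sweedler_tens. Qed.

Lemma sweedler_lin A B W (F : A -> B -> W) :
  (forall b, linear (F^~ b)) -> (forall a, linear (F a)) ->
  linear (sweedler^~ F).
Proof. by move=> Fl Fr; apply: sweedler_linear. Qed.

Lemma sweedler_sweedler A B C D W (t : A ⊗ B) (u : A -> B -> C ⊗ D)
    (F : C -> D -> W) :
  (forall d, linear (F^~ d)) -> (forall c, linear (F c)) ->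
  sweedler (sweedler t u) F = \sw_(a, b <- t) sweedler (u a b) F.
Proof. by move=> Fl Fr; exact: (linear_sweedler _ _ (sweedler_lin Fl Fr)). Qed.

Lemma scalel_lin U V (f : U -> K^o) (v : V) :
  linear f -> linear (fun x => f x *: v).
Proof. by move=> lf k x y; rewrite lf scalerDl -scalerA. Qed.

Lemma scaler_lin U V (k : K) (f : U -> V) :
  linear f -> linear (fun x => k *: f x).
Proof. by move=> lf l x y; rewrite lf scalerDr !scalerA mulrC. Qed.

Lemma tensZl U V k (u : U) (v : V) : (k *: u) ⊗ v = k *: (u ⊗ v).
Proof. by have [_ _ ->] := linearPB ((tens_bilinear U V).1 v). Qed.

Lemma tensZr U V k (u : U) (v : V) : u ⊗ (k *: v) = k *: (u ⊗ v).
Proof. by have [_ _ ->] := linearPB ((tens_bilinear U V).2 u). Qed.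

Lemma linear_scale U V (f : U -> V) : linear f -> forall k x, f (k *: x) = k *: f x.
Proof. by case/linearPB. Qed.

Lemma tensor_ext A B W (f g : A ⊗ B -> W) : linear f -> linear g ->
  (forall a b, f (a ⊗ b) = g (a ⊗ b)) -> forall t, f t = g t.
Proof.
move=> /linearPB[fD _ _ f0] /linearPB[gD _ _ g0] efg t.
have [s ->] := tensor_sum t.
rewrite (big_morph f fD f0) (big_morph g gD g0).
by apply: eq_bigr => p _; apply: efg.
Qed.

Lemma sweedler_tensE A B (t : A ⊗ B) : \sw_(a, b <- t) (a ⊗ b) = t.
Proof.
have [lA rA] := tens_bilinear A B.
apply: (tensor_ext (f := sweedler^~ _)) => [|//|a b]; first exact: sweedler_lin.
exact: sweedler_pure.
Qed.

End SweedlerCalculus.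

(** Proves linearity in one variable by descending through the expression: the variable sits either
    in the body of a Sweedler sum, or in the tensor summed over, or in one factor of a pure
    tensor. *)
Ltac lin := intros;
  first [ exact: id_lin | solve [auto 2]
  | apply: sweedler_body_linear; lin
  | apply: sweedler_comp_lin; lin
  | apply: scalel_lin; lin | apply: scaler_lin; lin
  | apply: tensl_lin; lin | apply: tensr_lin; lin
  | match goal with |- linear (fun x => ?f (@?g x)) =>
      apply: (@comp_lin _ _ _ _ f g); lin end ].

(** The universal property of the triple tensor product. Applying [G] to an axiom stated in that
    space makes it usable under an arbitrary trilinear expression. *)
Lemma trilinear_lift (K : fieldType) (U V W X : lmodType K)
    (F : U -> V -> W -> X) :
  (forall y z, linear (fun x => F x y z)) ->
  (forall x z, linear (fun y => F x y z)) ->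
  (forall x y, linear (fun z => F x y z)) ->
  exists2 G : U ⊗ (V ⊗ W) -> X,
    linear G & forall x y z, G (x ⊗ (y ⊗ z)) = F x y z.
Proof.
move=> F1 F2 F3; exists (fun s => \sw_(x, yz <- s) \sw_(y, z <- yz) F x y z).
  by lin.
by move=> x y z; rewrite !sweedler_pure; lin.
Qed.

Section BiproductAntipode.
Context (K : fieldType) (H A : lmodType K).
Context (mulH : H ⊗ H -> H) (oneH : H) (DeltaH : H -> H ⊗ H) (epsH : H -> K^o).
Context (beta SH : H -> H).
Context (mulA : A ⊗ A -> A) (oneA : A) (DeltaA : A -> A ⊗ A) (epsA : A -> K^o).
Context (alpha SA : A -> A) (act : H ⊗ A -> A) (rho : A -> H ⊗ A).

Local Notation alphaV := (inverse alpha).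
Local Notation betaV := (inverse beta).
Local Notation mulB := (biproduct_mul mulH DeltaH beta mulA alpha act).
Local Notation DeltaB := (biproduct_comul mulH DeltaH beta DeltaA alpha rho).
Local Notation epsB := (biproduct_counit epsH epsA).
Local Notation gamma := (biproduct_aut beta alpha).
Local Notation SB := (biproduct_antipode mulH DeltaH beta SH alpha SA act rho).

Hypothesis hopfH : hom_hopf_algebra mulH oneH DeltaH epsH beta SH.
Hypothesis modA :
  module_hom_algebra mulH oneH DeltaH epsH beta mulA oneA act alpha.
Hypothesis comodA :
  comodule_hom_coalgebra mulH oneH DeltaH epsH beta DeltaA epsA rho alpha.
Hypothesis bialgB : hom_bialgebra mulB (oneA ⊗ oneH) DeltaB epsB gamma.
Hypothesis SA_lin : linear SA.
Hypothesis SA_antipodel :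
  forall a, \sw_(a1, a2 <- DeltaA a) mulA (SA a1 ⊗ a2) = epsA a *: oneA.
Hypothesis SA_antipoder :
  forall a, \sw_(a1, a2 <- DeltaA a) mulA (a1 ⊗ SA a2) = epsA a *: oneA.
Hypothesis SA_alpha : forall a, alpha (SA a) = SA (alpha a).

Let bialgH := hom_hopf_bialg hopfH.
Let antiH := hom_hopf_antipode hopfH.
Let algH := hom_bialg_alg bialgH.
Let coalgH := hom_bialg_coalg bialgH.
Let algA := mha_algebra modA.
Let coalgA := chc_coalgebra comodA.
Let actA := mha_module modA.
Let coactA := chc_comodule comodA.
Let algB := hom_bialg_alg bialgB.
Let coalgB := hom_bialg_coalg bialgB.

Let mulH_lin : linear mulH := hom_mul_linear algH.
Let beta_lin : linear beta := hom_alg_aut_linear algH.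
Let beta_bij : bijective beta := hom_alg_aut_bij algH.
Let DeltaH_lin : linear DeltaH := hom_comul_linear coalgH.
Let epsH_lin : linear epsH := hom_counit_linear coalgH.
Let SH_lin : linear SH := hom_antipode_linear antiH.
Let mulA_lin : linear mulA := hom_mul_linear algA.
Let alpha_lin : linear alpha := hom_alg_aut_linear algA.
Let alpha_bij : bijective alpha := hom_alg_aut_bij algA.
Let DeltaA_lin : linear DeltaA := hom_comul_linear coalgA.
Let epsA_lin : linear epsA := hom_counit_linear coalgA.
Let act_lin : linear act := hom_act_linear actA.
Let rho_lin : linear rho := hom_coact_linear coactA.
Let mulB_lin : linear mulB := hom_mul_linear algB.
Let gamma_lin : linear gamma := hom_alg_aut_linear algB.
Let DeltaB_lin : linear DeltaB := hom_comul_linear coalgB.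
Let epsB_lin : linear epsB := hom_counit_linear coalgB.
Let betaV_lin : linear betaV := inverse_linear beta_bij beta_lin.
Let alphaV_lin : linear alphaV := inverse_linear alpha_bij alpha_lin.
Let betaK : cancel beta betaV := inverseK beta_bij.
Let betaVK : cancel betaV beta := inverseVK beta_bij.
Let alphaK : cancel alpha alphaV := inverseK alpha_bij.
Let alphaVK : cancel alphaV alpha := inverseVK alpha_bij.

(** * Inverse twists commute with the structure maps *)

Let alphaV_SA a : alphaV (SA a) = SA (alphaV a).
Proof. by apply: (bij_inj alpha_bij); rewrite alphaVK SA_alpha alphaVK. Qed.

Let betaV_SH h : betaV (SH h) = SH (betaV h).
Proof.
by apply: (bij_inj beta_bij); rewrite betaVK -(hom_antipode_aut antiH) betaVK.
Qed.

Let betaVM h h' : betaV (mulH (h ⊗ h')) = mulH (betaV h ⊗ betaV h').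
Proof.
by apply: (bij_inj beta_bij); rewrite (hom_alg_autM algH) !betaVK.
Qed.

Let betaV1 : betaV oneH = oneH.
Proof. by rewrite -{1}(hom_alg_aut1 algH) betaK. Qed.

Let alphaV1 : alphaV oneA = oneA.
Proof. by rewrite -{1}(hom_alg_aut1 algA) alphaK. Qed.

Let alphaVM a a' : alphaV (mulA (a ⊗ a')) = mulA (alphaV a ⊗ alphaV a').
Proof.
by apply: (bij_inj alpha_bij); rewrite (hom_alg_autM algA) !alphaVK.
Qed.

Lemma coact_inverse m :
  rho (alphaV m) = \sw_(m_1, m0 <- rho m) (betaV m_1 ⊗ alphaV m0).
Proof.
rewrite -{2}(alphaVK m) (hom_coact_aut coactA) sweedler_sweedler; [|lin..].
under eq_sweedler => a b do (rewrite sweedler_pure ?betaK ?alphaK; [|lin..]).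
by rewrite sweedler_tensE.
Qed.

(** H acts on [oneA] through the counit, so the action disappears and the counit axiom contracts the
    comultiplication of [h]. *)
Lemma biproduct_mul_homr a h h' :
  mulB ((a ⊗ h) ⊗ (oneA ⊗ h')) = alpha a ⊗ mulH (h ⊗ h').
Proof.
rewrite biproduct_mulE // /biproduct_mul_pure alphaV1.
under eq_sweedler => h1 h2 do
  rewrite (mha_act_one modA) tensZr (linear_scale mulA_lin) (hom_mulr1 algA) tensZl
    -tensZr -(linear_scale mulH_lin) -tensZl -(linear_scale betaV_lin).
rewrite -(linear_sweedler (f := fun x => _ ⊗ mulH (betaV x ⊗ h'))); last by lin.
by rewrite (hom_counitl coalgH) betaK.
Qed.

(** Here the comultiplied element is [oneH], which is grouplike and acts by [alpha], cancelling the
    inverse twist in the product. *)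
Lemma biproduct_mul_homl u a h :
  mulB ((u ⊗ oneH) ⊗ (a ⊗ h)) = mulA (u ⊗ a) ⊗ beta h.
Proof.
rewrite biproduct_mulE // /biproduct_mul_pure (hom_comul1 bialgH).
rewrite sweedler_pure; [|lin..].
by rewrite (hom_act1 actA) alphaVK betaV1 (hom_mul1r algH).
Qed.

Lemma biproduct_mul_hom_act x a :
  mulB ((oneA ⊗ x) ⊗ (a ⊗ oneH)) =
  \sw_(x1, x2 <- DeltaH x) (act (beta x1 ⊗ a) ⊗ x2).
Proof.
rewrite biproduct_mulE // /biproduct_mul_pure.
apply: eq_sweedler => x1 x2.
by rewrite (hom_mul1r algA) (hom_act_aut actA) alphaVK (hom_mulr1 algH) betaVK.
Qed.

Lemma comul_inverse x :
  DeltaH (betaV x) = \sw_(x1, x2 <- DeltaH x) (betaV x1 ⊗ betaV x2).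
Proof.
rewrite -{2}(betaVK x) (hom_comul_aut coalgH) sweedler_sweedler; [|lin..].
under eq_sweedler => a b do (rewrite sweedler_pure ?betaK; [|lin..]).
by rewrite sweedler_tensE.
Qed.

(** This form lets Hom-associativity of the biproduct act on the antipode; the given formula is its
    expansion by [biproduct_mul_hom_act]. *)
Lemma biproduct_antipode_prod a h :
  SB (a ⊗ h) =
  \sw_(a_1, a0 <- rho a)
    mulB ((oneA ⊗ betaV (SH (mulH (a_1 ⊗ betaV h))))
          ⊗ (SA (alphaV (alphaV a0)) ⊗ oneH)).
Proof.
rewrite biproduct_antipodeE // /biproduct_antipode_pure.
apply: eq_sweedler => a_1 a0; rewrite biproduct_mul_hom_act comul_inverse.
rewrite sweedler_sweedler; [|lin..]; apply: eq_sweedler => s1 s2.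
by rewrite sweedler_pure ?betaVK; lin.
Qed.

Lemma biproduct_comul_lift (W : lmodType K) (F : A ⊗ H -> A ⊗ H -> W) a h :
  (forall y, linear (F^~ y)) -> (forall x, linear (F x)) ->
  sweedler (DeltaB (a ⊗ h)) F =
  \sw_(a1, a2 <- DeltaA a) \sw_(a2_1, a20 <- rho a2)
  \sw_(h1, h2 <- DeltaH h)
    F (a1 ⊗ mulH (a2_1 ⊗ betaV h1)) (alphaV a20 ⊗ h2).
Proof.
move=> Fl Fr; rewrite biproduct_comulE // /biproduct_comul_pure.
rewrite sweedler_sweedler //; apply: eq_sweedler => a1 a2.
rewrite sweedler_sweedler //; apply: eq_sweedler => a2_1 a20.
rewrite sweedler_sweedler //; apply: eq_sweedler => h1 h2.
exact: sweedler_pure.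
Qed.

(** * Linearity of the antipode and compatibility with the automorphism *)

Lemma biproduct_antipode_linear : linear SB.
Proof.
rewrite /biproduct_antipode; apply: sweedler_lin => [h|a];
  by rewrite /biproduct_antipode_pure; lin.
Qed.

Lemma biproduct_antipode_aut x : SB (gamma x) = gamma (SB x).
Proof.
have SB_lin := biproduct_antipode_linear.
move: x; apply: tensor_ext; [lin..|] => a h.
rewrite biproduct_autE // biproduct_antipodeE // /biproduct_antipode_pure.
rewrite biproduct_antipodeE // /biproduct_antipode_pure.
rewrite (hom_coact_aut coactA) sweedler_sweedler; [|lin..].
rewrite (linear_sweedler _ _ gamma_lin); apply: eq_sweedler => a_1 a0.
rewrite sweedler_pure; [|lin..].
(* Writing h as β(β^{-1}(h)) lets β be pulled out of the product with a_{-1}, then out of S_H. *)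
rewrite betaK -{1}(betaVK h) -(hom_alg_autM algH) (hom_antipode_aut antiH).
rewrite (hom_comul_aut coalgH) sweedler_sweedler; [|lin..].
rewrite (linear_sweedler _ _ gamma_lin); apply: eq_sweedler => s1 s2.
rewrite sweedler_pure; [|lin..].
by rewrite biproduct_autE // (hom_act_aut actA) betaK betaVK
  SA_alpha alphaVK alphaK.
Qed.

(** * Coaction axioms under trilinear expressions *)

Lemma coact_comul_trilinear (W : lmodType K) (F : H -> A -> A -> W) a :
  (forall y z, linear (fun x => F x y z)) ->
  (forall x z, linear (fun y => F x y z)) ->
  (forall x y, linear (fun z => F x y z)) ->
  \sw_(a1, a2 <- DeltaA a) \sw_(a1_1, a10 <- rho a1)
    \sw_(a2_1, a20 <- rho a2) F (mulH (a1_1 ⊗ a2_1)) a10 a20 =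
  \sw_(a_1, a0 <- rho a) \sw_(a01, a02 <- DeltaA a0)
    F (beta (beta a_1)) a01 a02.
Proof.
move=> F1 F2 F3; have [G Gl GE] := trilinear_lift F1 F2 F3.
have := congr1 G (chc_coact_comul comodA a).
rewrite !(linear_sweedler _ _ Gl) => E.
transitivity (\sw_(c1, c2 <- DeltaA a) G (\sw_(c1_1, c10 <- rho c1)
  \sw_(c2_1, c20 <- rho c2) (mulH (c1_1 ⊗ c2_1) ⊗ (c10 ⊗ c20)))).
  apply: eq_sweedler => a1 a2; rewrite (linear_sweedler _ _ Gl).
  apply: eq_sweedler => a1_1 a10; rewrite (linear_sweedler _ _ Gl).
  by apply: eq_sweedler => a2_1 a20; rewrite GE.
rewrite -E; apply: eq_sweedler => a_1 a0; rewrite (linear_sweedler _ _ Gl).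
by apply: eq_sweedler => a01 a02; rewrite GE.
Qed.

Lemma coactA_trilinear (W : lmodType K) (F : H -> H -> A -> W) a :
  (forall y z, linear (fun x => F x y z)) ->
  (forall x z, linear (fun y => F x y z)) ->
  (forall x y, linear (fun z => F x y z)) ->
  \sw_(a_1, a0 <- rho a) \sw_(a0_1, a00 <- rho a0) F (beta a_1) a0_1 a00 =
  \sw_(a_1, a0 <- rho a) \sw_(a_11, a_12 <- DeltaH a_1)
    F a_11 a_12 (alpha a0).
Proof.
move=> F1 F2 F3; have [G Gl GE] := trilinear_lift F1 F2 F3.
have := congr1 G (hom_coactA coactA a).
rewrite !(linear_sweedler _ _ Gl) => E.
transitivity (\sw_(m_1, m0 <- rho a) G (\sw_(m0_1, m00 <- rho m0)
  (beta m_1 ⊗ (m0_1 ⊗ m00)))).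
  apply: eq_sweedler => a_1 a0; rewrite (linear_sweedler _ _ Gl).
  by apply: eq_sweedler => a0_1 a00; rewrite GE.
rewrite E; apply: eq_sweedler => a_1 a0; rewrite (linear_sweedler _ _ Gl).
by apply: eq_sweedler => a_11 a_12; rewrite GE.
Qed.

(** * The left antipode identity *)

Lemma antipode_left_term a h x m h2 :
  mulB (SB (a ⊗ mulH (x ⊗ betaV h)) ⊗ (alphaV m ⊗ h2)) =
  \sw_(y, n <- rho a)
    mulB ((oneA ⊗ SH (mulH (betaV (mulH (y ⊗ x)) ⊗ betaV h)))
          ⊗ (alphaV (alphaV (mulA (SA n ⊗ m))) ⊗ h2)).
Proof.
have SB_lin := biproduct_antipode_linear.
rewrite biproduct_antipode_prod.
rewrite (linear_sweedler (f := fun z => mulB (z ⊗ _))); last by lin.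
apply: eq_sweedler => y n.
(* Hom-associativity needs the outer right factor in the image of [gamma]; after it, S_A(n) and m
   are multiplied by [biproduct_mul_homl]. *)
have -> : alphaV m ⊗ h2 = gamma (alphaV (alphaV m) ⊗ betaV h2).
  by rewrite biproduct_autE // alphaVK betaVK.
rewrite -(hom_mulA algB) biproduct_autE // (hom_alg_aut1 algA) betaVK.
rewrite biproduct_mul_homl betaVK !alphaVM !alphaV_SA.
congr (mulB ((_ ⊗ SH _) ⊗ _)).
rewrite betaVM -{1}(betaVK y) (hom_mulA algH) betaVK.
by rewrite betaVM.
Qed.

Lemma biproduct_antipodel_pure a h :
  \sw_(b1, b2 <- DeltaB (a ⊗ h)) mulB (SB b1 ⊗ b2) =
  (epsB (a ⊗ h) : K) *: (oneA ⊗ oneH).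
Proof.
have SB_lin := biproduct_antipode_linear.
rewrite biproduct_comul_lift; [|lin..].
pose L z n m := \sw_(h1, h2 <- DeltaH h)
    mulB ((oneA ⊗ SH (mulH (betaV z ⊗ betaV h1)))
          ⊗ (alphaV (alphaV (mulA (SA n ⊗ m))) ⊗ h2)).
transitivity (\sw_(a1, a2 <- DeltaA a) \sw_(a1_1, a10 <- rho a1)
    \sw_(a2_1, a20 <- rho a2) L (mulH (a1_1 ⊗ a2_1)) a10 a20).
  apply: eq_sweedler => a1 a2; rewrite [RHS]sweedler_exchange.
  apply: eq_sweedler => x m; rewrite [RHS]sweedler_exchange.
  by apply: eq_sweedler => h1 h2; apply: antipode_left_term.
rewrite coact_comul_trilinear; try by rewrite /L; lin.
(* What remains once S_A has cancelled. The compatibility axiom supplies β^2, of which [betaV] in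
   [L] removes one factor, hence [beta c]. Linearity of [N] lets ε_A(a_0) move onto a_{-1}, where
   the counit axiom of the coaction applies. *)
pose N c := \sw_(h1, h2 <- DeltaH h)
  (oneA ⊗ mulH (SH (mulH (beta c ⊗ betaV h1)) ⊗ h2)).
have N_lin : linear N by rewrite /N; lin.
transitivity (\sw_(a_1, a0 <- rho a) N (epsA a0 *: a_1)).
  apply: eq_sweedler => a_1 a0; rewrite sweedler_exchange (linear_scale N_lin) /N.
  rewrite (linear_sweedler (f := fun x => _ *: x)); last by lin.
  apply: eq_sweedler => h1 h2; rewrite betaK.
  rewrite -(linear_sweedler
    (f := fun x => mulB (_ ⊗ (alphaV (alphaV x) ⊗ h2)))); last by lin.
  rewrite SA_antipodel !(linear_scale alphaV_lin) !alphaV1 tensZl.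
  by rewrite tensZr (linear_scale mulB_lin) biproduct_mul_homr (hom_alg_aut1 algA).
rewrite -(linear_sweedler _ _ N_lin) (chc_coact_counit comodA).
rewrite (linear_scale N_lin) /N.
under eq_sweedler => h1 h2 do
  rewrite (hom_alg_aut1 algH) (hom_mul1r algH) betaVK.
rewrite -(linear_sweedler (f := fun x => oneA ⊗ x)); last by lin.
by rewrite (hom_antipodel antiH) tensZr biproduct_counitE // scalerA.
Qed.

(** * The right antipode identity *)

Lemma antipode_right_term a x h1 m h2 :
  mulB ((a ⊗ mulH (x ⊗ betaV h1)) ⊗ SB (alphaV m ⊗ h2)) =
  \sw_(y, n <- rho m)
    mulB ((a ⊗ betaV (betaV (mulH (mulH (beta x ⊗ h1) ⊗ SH (mulH (y ⊗ h2))))))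
          ⊗ (SA (alphaV (alphaV n)) ⊗ oneH)).
Proof.
have SB_lin := biproduct_antipode_linear.
rewrite biproduct_antipode_prod coact_inverse sweedler_sweedler; [|lin..].
rewrite (linear_sweedler (f := fun z => mulB (_ ⊗ z))); last by lin.
apply: eq_sweedler => y n; rewrite sweedler_pure; [|lin..].
rewrite -betaVM.
(* Now the left factor must lie in the image of [gamma], so that it can be regrouped with the H-part
   of the antipode, where [biproduct_mul_homr] applies. *)
have -> : a ⊗ mulH (x ⊗ betaV h1) =
  gamma (alphaV a ⊗ mulH (betaV x ⊗ betaV (betaV h1))).
  by rewrite biproduct_autE // alphaVK (hom_alg_autM algH) !betaVK.
rewrite (hom_mulA algB) biproduct_mul_homr biproduct_autE // (hom_alg_aut1 algH).
rewrite alphaVK SA_alpha !alphaVK; congr (mulB ((_ ⊗ _) ⊗ _)).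
by rewrite !betaVM !betaV_SH betaK !betaVM.
Qed.

Lemma biproduct_antipoder_pure a h :
  \sw_(b1, b2 <- DeltaB (a ⊗ h)) mulB (b1 ⊗ SB b2) =
  (epsB (a ⊗ h) : K) *: (oneA ⊗ oneH).
Proof.
have SB_lin := biproduct_antipode_linear.
rewrite biproduct_comul_lift; [|lin..].
(* The cancellation of S_H takes place inside a_2 alone, so it is done for each [a1], [a2]
   separately; S_A cancels in the final sum. *)
transitivity (\sw_(a1, a2 <- DeltaA a)
    (epsH h : K) *: (mulA (a1 ⊗ SA a2) ⊗ oneH)); last first.
  rewrite -(linear_sweedler (f := fun x => (epsH h : K) *: (x ⊗ oneH)));
    last by lin.
  by rewrite SA_antipoder tensZl biproduct_counitE // !scalerA mulrC.
apply: eq_sweedler => a1 a2.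
pose Q u n := mulB ((a1 ⊗ betaV (betaV u)) ⊗ (SA (alphaV (alphaV n)) ⊗ oneH)).
pose L x y n := \sw_(h1, h2 <- DeltaH h)
  Q (mulH (mulH (x ⊗ h1) ⊗ SH (mulH (y ⊗ h2)))) n.
transitivity (\sw_(x, m <- rho a2) \sw_(y, n <- rho m) L (beta x) y n).
  apply: eq_sweedler => x m; rewrite [RHS]sweedler_exchange.
  by apply: eq_sweedler => h1 h2; apply: antipode_right_term.
rewrite coactA_trilinear; try by rewrite /L /Q; lin.
(* The visible [alpha] comes from coassociativity; summing [epsH x *: m] gives α(a_2), a second one.
   Together they cancel the α^{-2} inside [Q]. *)
transitivity (\sw_(x, m <- rho a2) (epsH h : K) *: Q oneH (alpha (epsH x *: m))).
  apply: eq_sweedler => x m.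
  (* Multiplicativity of Δ_H merges the sums over [x] and [h] into one comultiplication, to which
     the antipode axiom of H applies. *)
  transitivity (\sw_(u1, u2 <- DeltaH (mulH (x ⊗ h)))
      Q (mulH (u1 ⊗ SH u2)) (alpha m)).
    rewrite (hom_comulM bialgH) sweedler_sweedler; try by rewrite /Q; lin.
    apply: eq_sweedler => x1 x2; rewrite sweedler_sweedler; try by rewrite /Q; lin.
    by apply: eq_sweedler => h1 h2; rewrite sweedler_pure // /Q; lin.
  rewrite -(linear_sweedler (f := fun u => Q u (alpha m))); last by rewrite /Q; lin.
  rewrite (hom_antipoder antiH) (hom_counitM bialgH).
  rewrite (linear_scale (f := fun u => Q u (alpha m))); last by rewrite /Q; lin.
  rewrite (linear_scale (f := fun m => Q oneH (alpha m))); last by rewrite /Q; lin.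
  by rewrite scalerA mulrC.
rewrite -(linear_sweedler (f := fun m => (epsH h : K) *: Q oneH (alpha m)));
  last by rewrite /Q; lin.
rewrite (hom_coact1 coactA) /Q !betaV1 biproduct_mul_homl !alphaK.
by rewrite (hom_alg_aut1 algH).
Qed.

Lemma biproduct_hom_antipode :
  hom_antipode mulB (oneA ⊗ oneH) DeltaB epsB gamma SB.
Proof.
have SB_lin := biproduct_antipode_linear.
split=> //; last exact: biproduct_antipode_aut.
- by apply: tensor_ext biproduct_antipodel_pure; lin.
- by apply: tensor_ext biproduct_antipoder_pure; lin.
Qed.

End BiproductAntipode.

Theorem theorem3p6 (K : fieldType) (H A : lmodType K)
    (mulH : H ⊗ H -> H) (oneH : H) (DeltaH : H -> H ⊗ H) (epsH : H -> K^o)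
    (beta : H -> H) (SH : H -> H)
    (mulA : A ⊗ A -> A) (oneA : A) (DeltaA : A -> A ⊗ A) (epsA : A -> K^o)
    (alpha : A -> A) (SA : A -> A)
    (act : H ⊗ A -> A) (rho : A -> H ⊗ A) :
  hom_hopf_algebra mulH oneH DeltaH epsH beta SH ->
  hom_algebra mulA oneA alpha ->
  hom_coalgebra DeltaA epsA alpha ->
  module_hom_algebra mulH oneH DeltaH epsH beta mulA oneA act alpha ->
  comodule_hom_coalgebra mulH oneH DeltaH epsH beta DeltaA epsA rho alpha ->
  hom_bialgebra
    (biproduct_mul mulH DeltaH beta mulA alpha act) (oneA ⊗ oneH)
    (biproduct_comul mulH DeltaH beta DeltaA alpha rho)
    (biproduct_counit epsH epsA) (biproduct_aut beta alpha) ->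
  linear SA ->
  (forall a, \sw_(a1, a2 <- DeltaA a) mulA (SA a1 ⊗ a2) = epsA a *: oneA) ->
  (forall a, \sw_(a1, a2 <- DeltaA a) mulA (a1 ⊗ SA a2) = epsA a *: oneA) ->
  (forall a, alpha (SA a) = SA (alpha a)) ->
  hom_hopf_algebra
    (biproduct_mul mulH DeltaH beta mulA alpha act) (oneA ⊗ oneH)
    (biproduct_comul mulH DeltaH beta DeltaA alpha rho)
    (biproduct_counit epsH epsA) (biproduct_aut beta alpha)
    (biproduct_antipode mulH DeltaH beta SH alpha SA act rho).
Proof.
move=> hopfH _ _ modA comodA bialgB SA_lin SA_l SA_r SA_alpha; split=> //.
exact: (biproduct_hom_antipode hopfH modA comodA bialgB).
Qed.
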